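(* Let $v>0$. There exist a smooth, divergence-free vector field $u^0(x)$ on $\mathbb{R}^3$, a smooth $f(x,t)$ on $\mathbb{R}^3\times[0,\infty)$ and numbers $C_{\alpha,m,K}>0$ satisfying $$u^0(x+e_j)=u^0(x),\qquad f(x+e_j,t)=f(x,t),\qquad 1\le j\le3,$$ and $$|\partial_x^\alpha\partial_t^m f(x,t)|\le C_{\alpha,m,K}(1+|t|)^{-K}$$ for any $\alpha$, $m$ and $K$, such that there exist $a>0$ and a solution $(p,u)$ of the Navier-Stokes system on $\mathbb{R}^3\times[0,a)$ with viscosity $v$, force $f$ and initial field $u^0$, satisfying $$u(x,t)=u(x+e_j,t)\quad\text{on }\mathbb{R}^3\times[0,a),\ 1\le j\le3,$$ and $$p,u\in C^\infty(\mathbb{R}^3\times[0,a)),$$ that cannot be smoothly continued to $\mathbb{R}^3\times[0,\infty)$.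
   Context: $e_j$ denotes the $j$-th standard unit vector of $\mathbb{R}^3$; $\alpha$ ranges over multi-indices in the space variables, and $m$, $K$ over nonnegative integers. A solution of the Navier-Stokes system on $\mathbb{R}^3\times[0,a)$ with viscosity $v>0$, external force $f=(f_1,f_2,f_3)$ and initial field $u^0$ is a pair $(p,u)$, $u=(u_1,u_2,u_3)$, with $\frac{\partial u_i}{\partial t}+\sum_{j=1}^3u_j\frac{\partial u_i}{\partial x_j}=v\Delta u_i-\frac{\partial p}{\partial x_i}+f_i(x,t)$ for $1\le i\le3$, $\sum_{i=1}^3\frac{\partial u_i}{\partial x_i}=0$ on $\mathbb{R}^3\times[0,a)$, and $u(x,0)=u^0(x)$ for $x\in\mathbb{R}^3$. Here $\Delta$ is the Laplacian in the space variables, and the time derivative at $t=0$ is the limit as $t\to0^+$. The pressure is not required to be periodic in $x$. *)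

(* Defs.v *)
From mathcomp Require Import all_boot all_order all_algebra.
From mathcomp Require Import all_classical all_reals all_analysis.

Set Implicit Arguments.
Unset Strict Implicit.
Unset Printing Implicit Defensive.

Import Order.TTheory GRing.Theory Num.Theory.
Import numFieldNormedType.Exports.

Local Open Scope classical_set_scope.
Local Open Scope ring_scope.

Section SpaceTime.
Context {R : realType}.

Definition e_ (j : 'I_3) : 'rV[R]_3 := delta_mx 0 j.

Definition component (w : 'rV[R]_3 -> 'rV[R]_3) (i : 'I_3) : 'rV[R]_3 -> R :=
  fun x => w x 0 i.

Definition tcomponent (w : 'rV[R]_3 -> R -> 'rV[R]_3) (i : 'I_3) :
    'rV[R]_3 -> R -> R :=
  fun x t => w x t 0 i.

Definition enorm (w : 'rV[R]_3) : R := Num.sqrt (\sum_(i < 3) (w 0 i) ^+ 2).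

(* A field on R^3 x I, where I is a set of times, is represented by a total
   function; its values at times outside I are never used by the notions
   below. *)

Definition dx (j : 'I_3) (g : 'rV[R]_3 -> R -> R) : 'rV[R]_3 -> R -> R :=
  fun x t => 'D_(e_ j) (fun y => g y t) x.

Definition derivable_x (j : 'I_3) (g : 'rV[R]_3 -> R -> R) x t : Prop :=
  derivable (fun y => g y t) x (e_ j).

(* Only increments h with t + h in I are considered: the time derivative is the
   usual one at interior points of I and the limit as h -> 0+ at a left
   endpoint belonging to I. *)
Definition dt_filter (I : set R) (t : R) : set_system R :=
  within [set h | I (t + h)] (0 : R)^'.

Definition dt_quotient (g : 'rV[R]_3 -> R -> R) x (t h : R) : R :=
  h^-1 * (g x (t + h) - g x t).

Definition dt (I : set R) (g : 'rV[R]_3 -> R -> R) : 'rV[R]_3 -> R -> R :=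
  fun x t => lim (dt_quotient g x t @ dt_filter I t).

Definition derivable_t (I : set R) (g : 'rV[R]_3 -> R -> R) x t : Prop :=
  cvg (dt_quotient g x t @ dt_filter I t).

Definition Dmulti (I : set R) (al : {ffun 'I_3 -> nat}) (m : nat)
    (g : 'rV[R]_3 -> R -> R) : 'rV[R]_3 -> R -> R :=
  foldr (fun j => iter (al j) (dx j)) (iter m (dt I) g) (enum 'I_3).

(* All partial derivatives of order <= n, taken in any order, exist and are
   continuous on R^3 x I. *)
Fixpoint Cn_on (n : nat) (I : set R) (g : 'rV[R]_3 -> R -> R) : Prop :=
  {within [set z : 'rV[R]_3 * R | I z.2], continuous (fun z => g z.1 z.2)} /\
  match n with
  | 0 => True
  | k.+1 =>
      (forall j, (forall x t, I t -> derivable_x j g x t) /\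
                 Cn_on k I (dx j g)) /\
      (forall x t, I t -> derivable_t I g x t) /\ Cn_on k I (dt I g)
  end.

Definition smooth_on (I : set R) (g : 'rV[R]_3 -> R -> R) : Prop :=
  forall n, Cn_on n I g.

Definition vsmooth_on (I : set R) (w : 'rV[R]_3 -> R -> 'rV[R]_3) : Prop :=
  forall i, smooth_on I (tcomponent w i).

Fixpoint Cn_space (n : nat) (g : 'rV[R]_3 -> R) : Prop :=
  continuous g /\
  match n with
  | 0 => True
  | k.+1 => forall j, (forall x, derivable g x (e_ j)) /\
                      Cn_space k ('D_(e_ j) g)
  end.

Definition vsmooth_space (w : 'rV[R]_3 -> 'rV[R]_3) : Prop :=
  forall i n, Cn_space n (component w i).

Definition divergence_free (w : 'rV[R]_3 -> 'rV[R]_3) : Prop :=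
  forall x, \sum_(i < 3) 'D_(e_ i) (component w i) x = 0.

Definition laplacian (g : 'rV[R]_3 -> R -> R) : 'rV[R]_3 -> R -> R :=
  fun x t => \sum_(j < 3) dx j (dx j g) x t.

(* The derivatives are total operators (limits), so these equations are to be
   read together with the smoothness of p and u on R^3 x [0, a). *)
Definition NS_solution (v a : R) (f : 'rV[R]_3 -> R -> 'rV[R]_3)
    (u0 : 'rV[R]_3 -> 'rV[R]_3) (p : 'rV[R]_3 -> R -> R)
    (u : 'rV[R]_3 -> R -> 'rV[R]_3) : Prop :=
  [/\ forall x t, 0 <= t < a -> forall i : 'I_3,
        dt `[0, a[ (tcomponent u i) x t
          + \sum_(j < 3) u x t 0 j * dx j (tcomponent u i) x t
        = v * laplacian (tcomponent u i) x t - dx i p x t + f x t 0 i,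
      forall x t, 0 <= t < a -> \sum_(i < 3) dx i (tcomponent u i) x t = 0
    & forall x, u x 0 = u0 x].

(* The values of (p, u) on R^3 x [0, a) extend to smooth functions on
   R^3 x [0, oo); the extension need not solve any equation. *)
Definition smoothly_continuable (a : R) (p : 'rV[R]_3 -> R -> R)
    (u : 'rV[R]_3 -> R -> 'rV[R]_3) : Prop :=
  exists (P : 'rV[R]_3 -> R -> R) (U : 'rV[R]_3 -> R -> 'rV[R]_3),
    [/\ smooth_on `[0, +oo[ P, vsmooth_on `[0, +oo[ U
      & forall x t, 0 <= t < a -> P x t = p x t /\ U x t = u x t].

End SpaceTime.

(* Main.v *)
Require Import Defs.
From mathcomp Require Import all_boot all_order all_algebra.
From mathcomp Require Import all_classical all_reals all_analysis.
From mathcomp Require Import ring lra.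

Set Implicit Arguments.
Unset Strict Implicit.
Unset Printing Implicit Defensive.

Import Order.TTheory GRing.Theory Num.Theory.
Import numFieldNormedType.Exports.

Local Open Scope classical_set_scope.
Local Open Scope ring_scope.

(** The pressure is not required to be periodic, so the Navier-Stokes system
    has spatially uniform solutions with an arbitrary time profile: for any
    function phi of time, the field u(x, t) = phi(t) e_0 is periodic and
    divergence-free, its convection term and its Laplacian vanish, and the
    remaining equation phi'(t) e_0 = - grad p is solved by the linear pressure
    p(x, t) = - phi'(t) x_0. The force is f = 0, for which the decay bounds
    are trivial. With phi(t) = 1 / (1 - t) this solution starts from the
    constant field e_0, is smooth on [0, 1) and is unbounded as t tends to 1;
    a continuous extension U past t = 1 would give, in the limit t -> 1- of
    (1 - t) U_0(0, t) = 1, the contradiction 0 = 1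
    ([blowup_not_continuous]).

    The smoothness claims rest on [smooth_on_closed]: a family of continuous
    functions that is stable under every first-order partial derivative
    consists of smooth functions. It is applied to the functions
    (c + d x_0) (1 - t)^-k, among which are p and the components of u, and to
    the family reduced to the zero function. *)

(** * Derivatives and smoothness relative to a set of times *)

Section SmoothnessCriterion.
Context {R : realType}.
Implicit Types (I : set R) (g : 'rV[R]_3 -> R -> R).

Definition eq_on I g g' := forall x t, I t -> g x t = g' x t.

(** This makes [I] accumulate from the right at each of its points, so that
    the limit defining the time derivative relative to [I] is unique. *)
Definition right_open I := forall t, I t -> \forall h \near 0^'+, I (t + h).

Lemma right_open_co (a b : R) : right_open `[a, b[.
Proof.
move=> t /=; rewrite in_itv/= => /andP[at_ tb].
near=> h; have h0 : 0 < h by near: h; exact: nbhs_right_gt.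
have hb : h < b - t by near: h; apply: nbhs_right_lt; rewrite subr_gt0.
by rewrite in_itv/=; apply/andP; split; lra.
Unshelve. all: by end_near. Qed.

Lemma right_open_cy (a : R) : right_open `[a, +oo[.
Proof.
move=> t /=; rewrite in_itv/= andbT => at_.
near=> h; have h0 : 0 < h by near: h; exact: nbhs_right_gt.
by rewrite in_itv/= andbT; lra.
Unshelve. all: by end_near. Qed.

Lemma dt_filter_proper I t : right_open I -> I t ->
  ProperFilter (dt_filter I t).
Proof.
move=> oI It; have F : Filter (dt_filter I t) by exact: within_filter.
apply: Build_ProperFilter_ex => A dA.
suff : \forall h \near 0^'+, A h.
  by move=> /(@filter_ex _ _ (at_right_proper_filter 0)).
have dA' : \forall h \near 0^'+, I (t + h) -> A h.
  have d0 : \forall h \near (0 : R), h != 0 -> I (t + h) -> A h by exact: dA.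
  suff : \forall h \near (0 : R), 0 < h -> I (t + h) -> A h by [].
  by apply: filterS d0 => h Ah h0; apply: Ah; rewrite gt_eqF.
near=> h; apply: (near dA' h) => //.
by near: h; exact: oI.
Unshelve. all: by end_near. Qed.

Lemma dt_quotient_cvg I g (phi : R -> R) x t l : I t ->
  (forall s, I s -> g x s = phi s) -> is_derive t 1 phi l ->
  dt_quotient g x t @ dt_filter I t --> l.
Proof.
move=> It gphi [dphi <-].
have FF : Filter (dt_filter I t) by exact: within_filter.
pose q (h : R) := h^-1 *: ((phi \o shift t) (h *: 1) - phi t).
have qE : {near dt_filter I t, q =1 dt_quotient g x t}.
  rewrite near_withinE; apply: nearW => h /= Ith.
  rewrite /q /dt_quotient !gphi //= (_ : h%:A = h) ?[h + t]addrC //.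
  exact: mulr1.
apply: cvg_trans (near_eq_cvg qE) _.
by apply: cvg_trans dphi; apply: cvg_app; exact: cvg_within.
Qed.

(** Reduces time derivatives relative to [I] to ordinary ones: it suffices that
    the time profile of [g] at [x] agrees on [I] with a function [phi] that is
    differentiable at [t] in the usual two-sided sense, which is available even
    at the left endpoint of [I] when [phi] is given by a formula. *)
Lemma dt_eq I g (phi : R -> R) x t l : right_open I -> I t ->
  (forall s, I s -> g x s = phi s) -> is_derive t 1 phi l ->
  derivable_t I g x t /\ dt I g x t = l.
Proof.
move=> oI It gphi dphi; have c := dt_quotient_cvg It gphi dphi.
have FF := dt_filter_proper oI It.
by split; [apply/cvg_ex; exists l | exact: cvg_lim c].
Qed.

Lemma eq_on_slice I g g' t : eq_on I g g' -> I t -> g^~ t = g'^~ t.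
Proof. by move=> gh It; apply/funext => x; exact: gh. Qed.

Lemma dx_eq_on I j g g' : eq_on I g g' -> eq_on I (dx j g) (dx j g').
Proof. by move=> gh x t It; rewrite /dx (eq_on_slice gh It). Qed.

(** The functions [F a] form a family stable under first-order derivatives:
    [Dx] and [Dt] act on the parameters as the derivatives act on the
    functions. Continuity of the members is then enough, because the k-th
    derivatives are again members of the family. Members only need to match
    their derivatives on [I], hence the conclusion for every [g] that agrees
    with a member there: this is the form that the induction on the order
    carries through. *)
Lemma smooth_on_closed I (T : Type) (F : T -> 'rV[R]_3 -> R -> R)
    (Dx : 'I_3 -> T -> T) (Dt : T -> T) :
  right_open I ->
  (forall a, {within [set z : 'rV[R]_3 * R | I z.2],
               continuous (fun z => F a z.1 z.2)}) ->
  (forall a j x t, I t ->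
     is_derive x (e_ j) (fun y => F a y t) (F (Dx j a) x t)) ->
  (forall a x t, I t -> is_derive t 1 (F a x) (F (Dt a) x t)) ->
  forall a g, eq_on I g (F a) -> smooth_on I g.
Proof.
move=> oI cF dF tF a g gF n; elim: n a g gF => [|n IH] a g gF.
  split=> //; apply: subspace_eq_continuous (cF a).
  by move=> [x t]; rewrite inE => /= It; exact/esym/gF.
split; last split.
- apply: subspace_eq_continuous (cF a).
  by move=> [x t]; rewrite inE => /= It; exact/esym/gF.
- move=> j; split=> [x t It|].
    by rewrite /derivable_x (eq_on_slice gF It); case: (dF a j x t It).
  apply: (IH (Dx j a)) => x t It.
  rewrite (dx_eq_on j gF x It) /dx.
  by have [] := dF a j x t It.
- have gx x s : I s -> g x s = F a x s by exact: gF.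
  split=> [x t It|]; first by have [] := dt_eq oI It (gx x) (tF a x t It).
  apply: (IH (Dt a)) => x t It.
  by have [] := dt_eq oI It (gx x) (tF a x t It).
Qed.

Lemma Dmulti_eq0 I al m g : right_open I ->
  eq_on I g (fun _ _ => 0) -> eq_on I (Dmulti I al m g) (fun _ _ => 0).
Proof.
move=> oI g0; rewrite /Dmulti.
have x0 j (h : 'rV[R]_3 -> R -> R) :
    eq_on I h (fun _ _ => 0) -> eq_on I (dx j h) (fun _ _ => 0).
  move=> h0 x t It; rewrite (dx_eq_on j h0 x It) /dx.
  by rewrite derive_cst.
have t0 (h : 'rV[R]_3 -> R -> R) :
    eq_on I h (fun _ _ => 0) -> eq_on I (dt I h) (fun _ _ => 0).
  move=> h0 x t It.
  by have [] := dt_eq oI It (h0 x) (is_derive_cst (0 : R) t 1).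
elim: (enum _) => [|j s IH] /=.
  by elim: m => //= m; exact: t0.
by elim: (al j) => //= k; exact: x0.
Qed.

Lemma smooth_on_zero I : right_open I -> smooth_on I (fun _ _ => 0).
Proof.
move=> oI.
apply: (@smooth_on_closed _ unit (fun _ _ _ => 0) (fun _ => id) id oI _ _ _ tt).
- by move=> _; apply: continuous_subspaceT => z; exact: cvg_cst.
- by move=> *; exact: is_derive_cst.
- by [].
Qed.

Lemma Cn_space_cst n (b : R) : Cn_space n (fun=> b).
Proof.
elim: n b => [|n IH] b; split=> //; try exact: cst_continuous.
move=> j; split=> [x|]; first exact: derivable_cst.
rewrite (_ : 'D_(e_ j) _ = fun=> 0) //.
by apply/funext => x; rewrite derive_cst.
Qed.

Lemma within_continuous_slice (i : interval R) g x :
  {within [set z : 'rV[R]_3 * R | [set` i] z.2],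
     continuous (fun z => g z.1 z.2)} ->
  {within [set` i], continuous (g x)}.
Proof.
move=> cg; apply/subspace_continuousP => t it.
move/subspace_continuousP: cg => /(_ (x, t) it) cg.
apply: (@cvg_trans _ ((fun z => g z.1 z.2) @
   ((fun s : R => (x, s)) @ within [set` i] (nbhs t)))) => //.
apply: cvg_trans cg; apply: cvg_app => A A1.
have {}A1 : \forall z \near (x, t), z.2 \in i -> A z by exact: A1.
have ct : (x, s) @[s --> t] --> (x, t).
  by apply: (@cvg_pair _ _ _ _ (nbhs x) (nbhs t));
    [exact: cvg_cst | exact: cvg_id].
exact: (ct _ A1).
Qed.

End SmoothnessCriterion.

(** * Functions affine in space with a pole in time *)

Section BlowUp.
Context {R : realType}.

(** A family that contains the velocity components
    (c = 0 or 1, d = 0, k = 1) and the pressure (c = 0, d = -1, k = 2) and is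
    stable under differentiation, where (c, d, k) is the triple of
    parameters. *)
Definition affine_blowup (c : R * R * nat) (x : 'rV[R]_3) (t : R) : R :=
  (c.1.1 + c.1.2 * x 0 0) * (1 - t)^-1 ^+ c.2.

Lemma is_derive_blowup (k : nat) (t : R) : t < 1 ->
  is_derive t 1 (fun s : R => (1 - s)^-1 ^+ k) (k%:R * (1 - t)^-1 ^+ k.+1).
Proof.
move=> t1.
have t0 : 1 - t != 0 by rewrite subr_eq0 gt_eqF.
have dV : is_derive t 1 (fun s : R => (1 - s)^-1) ((1 - t)^-1 ^+ 2).
  have d1 : is_derive t 1 (fun s : R => 1 - s) (-1).
    have := is_deriveB (is_derive_cst (1 : R) t 1) (is_derive_id t 1).
    by rewrite sub0r.
  split; first by apply: derivableV => //; case: d1.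
  by rewrite deriveV//; have [_ ->] := d1; rewrite /GRing.scale/=; field.
have := @is_deriveX _ _ (fun s : R => (1 - s)^-1) k t 1 _ dV.
rewrite exprfctE => d; apply: is_derive_eq d _; rewrite /GRing.scale/=.
by case: k => [|k]; rewrite ?mul0r//= !exprS expr0; ring.
Qed.

Lemma is_derive_affine (c d b : R) (j : 'I_3) (x : 'rV[R]_3) :
  is_derive x (e_ j) (fun y : 'rV[R]_3 => (c + d * y 0 0) * b)
    (d * (j == 0)%:R * b).
Proof.
(* The function is affine, so its difference quotients are constant. *)
have q : ((fun h => h^-1 *: (((fun y : 'rV[R]_3 => (c + d * y 0 0) * b)
    \o shift x) (h *: e_ j) - (c + d * x 0 0) * b)) @ (0 : R)^') -->
    (d * (j == 0)%:R * b).
  apply: cvg_near_cst; near=> h.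
  have h0 : h != 0 by near: h; exact: nbhs_dnbhs_neq.
  rewrite /shift/= /e_ !mxE eqxx/= [0 == j]eq_sym /GRing.scale/=.
  by field.
split; first by apply/cvg_ex; exists (d * (j == 0)%:R * b).
exact: cvg_lim q.
Unshelve. all: by end_near. Qed.

Lemma is_derive_affine_blowup c (x : 'rV[R]_3) (t : R) : t < 1 ->
  is_derive t 1 (affine_blowup c x)
    (affine_blowup (c.2%:R * c.1.1, c.2%:R * c.1.2, c.2.+1) x t).
Proof.
move=> t1; rewrite /affine_blowup.
have d := is_deriveZ (c.1.1 + c.1.2 * x 0 0) (is_derive_blowup c.2 t1).
by apply: is_derive_eq d _; rewrite /GRing.scale/=; ring.
Qed.

Lemma smooth_on_affine_blowup c g :
  eq_on `[0, 1[ g (affine_blowup c) -> smooth_on `[0, 1[ g.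
Proof.
apply: (smooth_on_closed
  (Dx := fun j c => (c.1.2 * (j == 0)%:R, 0, c.2))
  (Dt := fun c => (c.2%:R * c.1.1, c.2%:R * c.1.2, c.2.+1))).
- exact: right_open_co.
- move=> {}c; apply: continuous_in_subspaceT => -[x t].
  rewrite inE/= in_itv/= => /andP[_ t1].
  have t0 : 1 - t != 0 by rewrite subr_eq0 gt_eqF.
  have cx : {for (x, t), continuous (fun z : 'rV[R]_3 * R => z.1 0 0)}.
    apply: (@continuous_comp _ _ _ fst (fun y : 'rV[R]_3 => y 0 0)).
      exact: cvg_fst.
    exact: coord_continuous.
  have ct : {for (x, t), continuous (fun z : 'rV[R]_3 * R => (1 - z.2)^-1)}.
    by apply: cvgV => //; apply: cvgB; [exact: cvg_cst | exact: cvg_snd].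
  apply: cvgM.
    apply: cvgD; first exact: cvg_cst.
    by apply: cvgM; [exact: cvg_cst | exact: cx].
  exact: (continuous_comp ct (@exprn_continuous _ c.2 _)).
- move=> {}c j x t _.
  apply: is_derive_eq (is_derive_affine _ _ _ _ _) _.
  by rewrite /affine_blowup/= mul0r addr0.
- move=> {}c x t /=; rewrite in_itv/= => /andP[_ t1].
  exact: is_derive_affine_blowup.
Qed.

(** A function continuous at 1 is bounded near 1, so (1 - t) U(t) would tend
    to 0 there, whereas it is identically 1 on [0, 1). *)
Lemma blowup_not_continuous (U : R -> R) :
  {within `[0, +oo[, continuous U} ->
  (forall t, 0 <= t < 1 -> U t = (1 - t)^-1) -> False.
Proof.
move=> /subspace_continuousP cU UE.
have U1 : U t @[t --> 1^'-] --> U 1.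
  apply: cvg_trans (cU 1 _); last by rewrite /= in_itv/= ler01.
  apply: cvg_app => A A1.
  have A1' : \forall t \near (1 : R), t \in `[0, +oo[ -> A t by exact: A1.
  suff : \forall t \near (1 : R), t < 1 -> A t by [].
  near=> t => _; apply: (near A1' t) => //.
  by rewrite in_itv/= andbT ltW//; near: t; exact: lt_nbhsr ltr01.
have e : (1 - t) * U t @[t --> 1^'-] --> (1 - 1) * U 1.
  apply: cvgM U1; apply: cvgB; first exact: cvg_cst.
  exact: cvg_at_left_filter.
have e1 : (1 - t) * U t @[t --> 1^'-] --> (1 : R).
  apply: cvg_near_cst; near=> t.
  have t1 : t < 1 by near: t; exact: nbhs_left_lt.
  have t0 : 0 < t by near: t; exact: nbhs_left_gt.
  by rewrite UE ?ltW// mulfV// subr_eq0 gt_eqF.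
have := cvg_lim (@Rhausdorff R) e; rewrite (cvg_lim (@Rhausdorff R) e1).
by rewrite subrr mul0r => /(_ _)/eqP; rewrite oner_eq0.
Unshelve. all: by end_near. Qed.

End BlowUp.

(** * The counterexample *)

Theorem theorem2p3 (R : realType) (v : R) (hv : 0 < v) :
  exists (u0 : 'rV[R]_3 -> 'rV[R]_3) (f : 'rV[R]_3 -> R -> 'rV[R]_3)
         (C : {ffun 'I_3 -> nat} -> nat -> nat -> R),
    (vsmooth_space u0 /\ divergence_free u0 /\ vsmooth_on `[0, +oo[ f) /\
    (forall al m K, 0 < C al m K) /\
    (forall j x, u0 (x + e_ j) = u0 x) /\
    (forall j x t, 0 <= t -> f (x + e_ j) t = f x t) /\
    (forall al m K x t, 0 <= t ->
       enorm (\row_(i < 3) Dmulti `[0, +oo[ al m (tcomponent f i) x t)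
         <= C al m K * (1 + `|t|) ^- K) /\
    exists (a : R) (p : 'rV[R]_3 -> R -> R) (u : 'rV[R]_3 -> R -> 'rV[R]_3),
      0 < a /\
      NS_solution v a f u0 p u /\
      (forall j x t, 0 <= t < a -> u x t = u (x + e_ j) t) /\
      smooth_on `[0, a[ p /\ vsmooth_on `[0, a[ u /\
      ~ smoothly_continuable a p u.
Proof.
pose u (_ : 'rV[R]_3) (t : R) : 'rV[R]_3 := (1 - t)^-1 *: e_ 0.
pose p : 'rV[R]_3 -> R -> R := affine_blowup (0, -1, 2%N).
have uE i : tcomponent u i = affine_blowup ((i == 0)%:R, 0, 1%N).
  apply/funext => x; apply/funext => t.
  by rewrite /tcomponent /affine_blowup /= !mxE eqxx/= mul0r addr0 mulrC.
have dxu i j x t : dx j (tcomponent u i) x t = 0 by rewrite /dx derive_cst.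
exists (fun=> e_ 0), (fun _ _ => 0), (fun _ _ _ => 1).
split.
  split; last split.
  - by move=> i n; exact: Cn_space_cst.
  - by move=> x; rewrite big1// => i _; rewrite derive_cst.
  - move=> i; rewrite (_ : tcomponent _ i = fun _ _ => 0).
      by apply: smooth_on_zero; exact: right_open_cy.
    by apply/funext => x; apply/funext => t; rewrite /tcomponent mxE.
split; first by move=> *; exact: ltr01.
split=> //; split=> //; split.
  move=> al m K x t t0.
  rewrite /enorm big1 ?sqrtr0 ?mul1r.
    by rewrite invr_ge0 exprn_ge0// addr_ge0.
  move=> i _; rewrite mxE (Dmulti_eq0 al m (@right_open_cy _ 0)) ?expr0n//.
    by move=> ? ? _; rewrite /tcomponent mxE.
  by rewrite /= in_itv/= t0.
exists 1, p, u; split; first exact: ltr01.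
split; first split.
- move=> x t t01 i.
  have It : [set` `[0, 1[] t by rewrite /= in_itv.
  have t1 : t < 1 by case/andP: t01.
  have [_ ->] : derivable_t `[0, 1[ (tcomponent u i) x t /\
      dt `[0, 1[ (tcomponent u i) x t = (i == 0)%:R * (1 - t)^-1 ^+ 2.
    apply: (dt_eq (@right_open_co _ 0 1) It
      (phi := affine_blowup ((i == 0)%:R, 0, 1%N) x)).
      by move=> s _; rewrite uE.
    apply: is_derive_eq (is_derive_affine_blowup _ _ t1) _.
    by rewrite /affine_blowup /= !mul1r mul0r addr0.
  have -> : laplacian (tcomponent u i) x t = 0.
    rewrite /laplacian big1// => j _.
    rewrite (_ : dx j (tcomponent u i) = fun _ _ => 0) ?/dx ?derive_cst//.
    by apply/funext => ?; apply/funext => ?; exact: dxu.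
  rewrite big1 ?addr0; last by move=> j _; rewrite dxu mulr0.
  have [_] := is_derive_affine 0 (-1) ((1 - t)^-1 ^+ 2) i x.
  rewrite /p /dx /affine_blowup /= => ->.
  by rewrite mxE mulr0 add0r addr0 mulN1r mulNr opprK.
- by move=> x t _; rewrite big1.
- by move=> x; rewrite /u subr0 invr1 scale1r.
split=> //; split; first exact: (@smooth_on_affine_blowup _ (0, -1, 2%N)).
split.
  move=> i; rewrite uE.
  exact: (@smooth_on_affine_blowup _ ((i == 0)%:R, 0, 1%N)).
move=> [P [U [_ sU PU]]].
have [cU _] := sU 0 0%N.
apply: (@blowup_not_continuous _ (tcomponent U 0 0)).
  exact: within_continuous_slice cU.
move=> t t01; rewrite /tcomponent; have [_ ->] := PU 0 t t01.
by rewrite !mxE eqxx mulr1.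
Qed.
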